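(* Let $A,B,C$ be real symmetric $n\times n$ matrices with $B\succ 0$, $C\succ 0$, and let $0<\alpha<\beta<+\infty$. Let $(s_k,t_k)_{k\ge1}$ be the iterates of the Frank-Wolfe algorithm (described in the context) for solving (HP): $\min_{(s,t)\in\Omega} f(s,t)=s-\sqrt t$, with stepsizes $\gamma_k=\frac{2}{k+2}$ or by exact line search, and assume that for every $k$ all eigenvalues of $A-\frac{1}{2\sqrt{t_k}}B$ have multiplicity $1$. Let $(s^*,t^* )$ be the optimal solution of (HP). Then for every $k\ge1$, $$|t_k-t^*|\ \le\ 4\sqrt{t_{\max}}\,\sqrt{\frac{LD^2\sqrt{t_{\max}}}{k+2}}.$$
   Context: $M\succ0$ means that the symmetric matrix $M$ is positive definite. $\Omega=\{(x^TAx,x^TBx):\alpha\le x^TCx\le\beta,\ x\in\mathbb{R}^n\}\subset\mathbb{R}^2$; since $\alpha>0$ and $B\succ0$, every $(s,t)\in\Omega$ has $t>0$. For a symmetric matrix $M$ and $N\succ0$, $\lambda_{\max}(M,N)$ and $\lambda_{\min}(M,N)$ denote the largest and smallest generalized eigenvalues of the pencil $(M,N)$ (scalars $\lambda$ with $Mv=\lambda Nv$ for some $v\ne0$). Frank-Wolfe algorithm for (HP): start from an initial point $(s_1,t_1)\in\Omega$ with $k=1$. For $k=1,2,\dots$: let $(\hat s_k,\hat t_k)$ be an optimal solution of $\min_{(s,t)\in\Omega}\ s-\frac{1}{2\sqrt{t_k}}t$; choose a stepsize $\gamma_k$; set $(s_{k+1},t_{k+1})=(1-\gamma_k)(s_k,t_k)+\gamma_k(\hat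 s_k,\hat t_k)$. The stepsize rule is either $\gamma_k=\frac{2}{k+2}$ or exact line search, $\gamma_k\in\arg\min_{\gamma\in[0,1]} f\big((1-\gamma)(s_k,t_k)+\gamma(\hat s_k,\hat t_k)\big)$. Constants: $t_{\max}=\lambda_{\max}(B,C)\beta$, $t_{\min}=\lambda_{\min}(B,C)\alpha$, $s_{\max}=\max\{\lambda_{\max}(A,C)\beta,\lambda_{\max}(A,C)\alpha\}$, $s_{\min}=\min\{\lambda_{\min}(A,C)\alpha,\lambda_{\min}(A,C)\beta\}$, $L=\frac{1}{4\,t_{\min}^{3/2}}$, $D=\sqrt{(s_{\max}-s_{\min})^2+(t_{\max}-t_{\min})^2}$. *)

(* Defs.v *)
From HB Require Import structures.
From mathcomp Require Import all_boot all_order all_algebra.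
From mathcomp Require Import all_classical all_reals all_analysis.

Set Implicit Arguments.
Unset Strict Implicit.
Unset Printing Implicit Defensive.

Import Order.TTheory GRing.Theory Num.Theory.

Local Open Scope classical_set_scope.
Local Open Scope ring_scope.

Section Pencil.
Context {R : realType} {n : nat}.
Implicit Types (M N : 'M[R]_n) (x : 'cV[R]_n).

Definition qform M x : R := (x^T *m M *m x) 0 0.

Definition posdefmx M : Prop :=
  M \is symmetricmx /\ forall x, x != 0 -> 0 < qform M x.

Definition gen_eigenvalues M N : set R :=
  [set l | exists2 v : 'cV[R]_n, v != 0 & M *m v = l *: (N *m v)].

(* For M symmetric, N positive definite and n > 0, the set of generalized
   eigenvalues is finite and nonempty, so its sup and inf are its largest and
   smallest elements. *)
Definition lambda_max M N : R := sup (gen_eigenvalues M N).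
Definition lambda_min M N : R := inf (gen_eigenvalues M N).

(* Multiplicity is algebraic: the order of the root of the characteristic
   polynomial.  For the symmetric matrices to which this is applied, it agrees
   with the geometric multiplicity and every complex eigenvalue is real. *)
Definition simple_spectrum M : Prop :=
  forall l : R, eigenvalue M l -> mup l (char_poly M) = 1%N.

End Pencil.

Definition is_argmin {R : realType} {T : Type} (S : set T) (g : T -> R) (p : T)
  : Prop := S p /\ forall q, S q -> g p <= g q.

Section FrankWolfe.
Context {R : realType} {n : nat}.
Variables (A B C : 'M[R]_n) (alpha beta : R).

Definition Omega : set (R * R) :=
  [set (qform A x, qform B x) | x in [set x | alpha <= qform C x <= beta]].

Definition objective (p : R * R) : R := p.1 - Num.sqrt p.2.

Definition fw_step (g : R) (p q : R * R) : R * R :=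
  ((1 - g) * p.1 + g * q.1, (1 - g) * p.2 + g * q.2).

(* The sequences are indexed from 1: the values at 0 are junk. *)
Definition frank_wolfe (z zhat : nat -> R * R) (gamma : nat -> R) : Prop :=
  [/\ Omega (z 1%N),
      forall k, (1 <= k)%N ->
        is_argmin Omega (fun p => p.1 - 1 / (2 * Num.sqrt (z k).2) * p.2)
          (zhat k)
    & forall k, (1 <= k)%N -> z k.+1 = fw_step (gamma k) (z k) (zhat k)].

Definition diminishing_stepsize (gamma : nat -> R) : Prop :=
  forall k, (1 <= k)%N -> gamma k = 2 / (k%:R + 2).

Definition exact_line_search (z zhat : nat -> R * R) (gamma : nat -> R)
  : Prop :=
  forall k, (1 <= k)%N ->
    is_argmin (`[0, 1] : set R) (fun g : R => objective (fw_step g (z k) (zhat k)))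
      (gamma k).

Definition t_max : R := lambda_max B C * beta.
Definition t_min : R := lambda_min B C * alpha.
Definition s_max : R :=
  Num.max (lambda_max A C * beta) (lambda_max A C * alpha).
Definition s_min : R :=
  Num.min (lambda_min A C * alpha) (lambda_min A C * beta).
Definition L_const : R := 1 / (4 * t_min `^ (3 / 2)).
Definition D_const : R :=
  Num.sqrt ((s_max - s_min) ^+ 2 + (t_max - t_min) ^+ 2).

End FrankWolfe.

(* Main.v *)
(** The region above [Omega] in the direction of [s] is convex: a convex
    combination of two points of [Omega] is dominated by a point of [Omega] with
    the same [t], by a rotation argument in the plane of the two underlying
    vectors.  Hence the minimiser [p] satisfies the first-order condition
    [s >= s_p + (t - t_p) / (2 sqrt t_p)] on [Omega], and on all iterates.  As
    [- sqrt] has second derivative at least [1 / (4 t_max^(3/2))], the square of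
    [t_k - t_p] is at most [8 t_max^(3/2)] times the objective gap, and the
    Frank-Wolfe recursion bounds that gap by [2 L D^2 / (k + 2)].

    The gap at iteration 1 may exceed this bound, so the recursion is not run on
    the gap itself.  With the diminishing stepsizes, [s_1] is replaced by its
    smallest value allowed by the first-order condition, which changes neither the
    [t_k] nor the recursion.  With exact line search, comparison with the full step
    makes the gap small at iteration 2, where the recursion starts. *)

Require Import Defs.
From HB Require Import structures.
From mathcomp Require Import all_boot all_order all_algebra.
From mathcomp Require Import all_classical all_reals all_analysis.
From mathcomp Require Import ring lra.

Set Implicit Arguments.
Unset Strict Implicit.

Import Order.TTheory GRing.Theory Num.Theory.
Import numFieldNormedType.Exports.
Local Open Scope classical_set_scope.
Local Open Scope ring_scope.

(** * Quadratic forms and kernels of semidefinite matrices *)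

Section QuadraticForms.
Context {R : realType} {n : nat}.
Implicit Types (M N : 'M[R]_n) (x y : 'cV[R]_n).

Definition bform M x y : R := (x^T *m M *m y) 0 0.

Lemma qform0 M : qform M 0 = 0.
Proof. by rewrite /qform mulmx0 mxE. Qed.

Lemma qformZ M (a : R) x : qform M (a *: x) = a ^+ 2 * qform M x.
Proof.
by rewrite /qform [(a *: x)^T]linearZ /= -!scalemxAl -scalemxAr !mxE mulrA expr2.
Qed.

Lemma qformMB M N (a : R) x : qform (M - a *: N) x = qform M x - a * qform N x.
Proof.
by rewrite /qform mulmxBr mulmxBl -scalemxAr -scalemxAl !mxE.
Qed.

Lemma qformMN M x : qform (- M) x = - qform M x.
Proof. by rewrite /qform mulmxN mulNmx mxE. Qed.

Lemma qform_comb M (a b : R) x y :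
  qform M (a *: x + b *: y) =
  a ^+ 2 * qform M x + a * b * (bform M x y + bform M y x) +
  b ^+ 2 * qform M y.
Proof.
have -> : qform M (a *: x + b *: y) =
    ((a *: x^T + b *: y^T) *m M *m (a *: x + b *: y)) 0 0.
  by rewrite /qform [(_ + _)^T]linearD /= ![(_ *: _)^T]linearZ.
rewrite /qform /bform !(mulmxDl, mulmxDr) -!(scalemxAl, scalemxAr).
by rewrite !mxE; ring.
Qed.

Lemma symmetricmxP M : reflect (M^T = M) (M \is symmetricmx).
Proof.
apply: (iffP (is_hermitianmxP _ _ _)); rewrite expr0 scale1r map_mx_id //.
Qed.

Lemma bform_sym M x y : M \is symmetricmx -> bform M x y = bform M y x.
Proof.
move=> /symmetricmxP hM; rewrite /bform -{1}hM -[x^T]mulmx1 -[in LHS](trmxK y).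
by rewrite mulmx1 -!trmx_mul mxE mulmxA.
Qed.

Lemma qform1_eq0 x : (x^T *m x) 0 0 = 0 -> x = 0.
Proof.
rewrite mxE => /eqP; rewrite psumr_eq0; last first.
  by move=> i _; rewrite mxE -expr2 sqr_ge0.
move=> /allP h; apply/colP => i; rewrite mxE.
have := h i (mem_index_enum _); rewrite mxE -expr2 sqrf_eq0.
by move=> /eqP.
Qed.

(* A zero of a nonnegative quadratic form is a minimiser, so the gradient
   vanishes there. *)
Lemma psd_ker M x : M \is symmetricmx -> (forall y, 0 <= qform M y) ->
  qform M x = 0 -> M *m x = 0.
Proof.
move=> hM psd hx; apply: qform1_eq0; set y := M *m x.
have -> : (y^T *m y) 0 0 = bform M y x by rewrite /bform mulmxA.
set b := bform M y x; set Q := qform M y.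
have Q0 : 0 <= Q by exact: psd.
(* A descent step along [y]; dividing by [Q + 1] rather than [Q] also covers [Q = 0]. *)
have := psd (1 *: x + (- b / (Q + 1)) *: y).
rewrite qform_comb hx (bform_sym x) // -/b -/Q => h.
apply/eqP; rewrite -sqrf_eq0 eq_le sqr_ge0 andbT leNgt; apply/negP => b2.
have Q1 : Q + 1 != 0 by lra.
move: h; rewrite leNgt => /negP; apply.
have -> : 1 ^+ 2 * 0 + 1 * (- b / (Q + 1)) * (b + b) +
  (- b / (Q + 1)) ^+ 2 * Q = - (b ^+ 2 * (Q + 2) / (Q + 1) ^+ 2).
  by field.
rewrite oppr_lt0; apply: divr_gt0; first by apply: mulr_gt0 => //; lra.
by apply: exprn_gt0; lra.
Qed.

(** * Extreme generalized eigenvalues as extrema of the Rayleigh quotient *)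

Lemma continuous_qform_tr M : continuous (fun v : 'rV[R]_n => qform M v^T).
Proof.
have -> : (fun v : 'rV[R]_n => qform M v^T) =
    (fun v => \sum_i (\sum_j v 0 j * M j i) * v 0 i).
  apply/funext => v; rewrite /qform trmxK mxE; apply: eq_bigr => i _.
  by rewrite !mxE.
have csum (f : 'I_n -> 'rV[R]_n -> R) :
    (forall i, continuous (f i)) -> continuous (fun v => \sum_i f i v).
  move=> cf v; apply: cvg_big; last by move=> i _; exact: cf.
    exact: add_continuous.
  exact: nbhs_filter.
have cinner i : continuous (fun v : 'rV[R]_n => \sum_j v 0 j * M j i).
  apply: (csum (fun j v => v 0 j * M j i)) => j w.
  by apply: continuousM; [exact: coord_continuous | exact: cst_continuous].
apply: (csum (fun i v => (\sum_j v 0 j * M j i) * v 0 i)) => i v.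
by apply: continuousM; [exact: cinner | exact: coord_continuous].
Qed.

Lemma compact_unit_sphere : compact [set v : 'rV[R]_n | `|v| = 1].
Proof.
apply: bounded_closed_compact.
  by exists 1; split => // e e1 v /= ->; exact: ltW.
apply: (closed_comp (f := fun v : 'rV[R]_n => `|v|) (D := [set 1])).
  by move=> v _; exact: norm_continuous.
exact: closed_eq.
Qed.

Lemma posdef_qform_ge0 M x : posdefmx M -> 0 <= qform M x.
Proof.
move=> [_ hM]; have [->|/hM/ltW//] := eqVneq x 0; by rewrite qform0.
Qed.

(** Take for [l] the maximum of the Rayleigh quotient on the compact unit sphere. Then [l *: N - M]
    is positive semidefinite and its form vanishes at the maximiser, which [psd_ker] turns into an
    eigenvector. *)
Lemma gen_eigenvalue_dominating M N : (0 < n)%N ->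
  M \is symmetricmx -> posdefmx N ->
  exists2 l, gen_eigenvalues M N l & forall x, qform M x <= l * qform N x.
Proof.
move=> n0 hM hN; have [symN posN] := hN.
pose S := [set v : 'rV[R]_n | `|v| = 1].
have S_unit (v : 'rV[R]_n) : v != 0 -> S (`|v|^-1 *: v).
  move=> v0; rewrite /S /= normrZ normfV normr_id mulVf // normr_eq0 //.
have S0 : S !=set0.
  exists (`|const_mx 1 : 'rV[R]_n|^-1 *: const_mx 1); apply: S_unit.
  apply/eqP => /rowP /(_ (Ordinal n0)); rewrite !mxE => /eqP.
  by rewrite oner_eq0.
have tr0 (v : 'rV[R]_n) : S v -> v^T != 0.
  move=> Sv; apply/eqP => /(congr1 trmx); rewrite trmxK trmx0 => v0.
  by move: Sv; rewrite /S /= v0 normr0 => /eqP; rewrite eq_sym oner_eq0.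
have [v0 Sv0 v0max] : exists2 c, c \in S & forall t, t \in S ->
    qform M t^T / qform N t^T <= qform M c^T / qform N c^T.
  apply: EVT_max_rV => //; first exact: compact_unit_sphere.
  apply/continuous_in_subspaceT => v; rewrite inE => Sv.
  apply: (@continuousM _ _ (fun t : 'rV[R]_n => qform M t^T)
                           (fun t => (qform N t^T)^-1)).
    exact: continuous_qform_tr.
  apply: continuousV; last exact: continuous_qform_tr.
  by rewrite gt_eqF // posN // tr0.
rewrite inE in Sv0; set l := qform M v0^T / _ in v0max.
have dom x : qform M x <= l * qform N x.
  have [->|x0] := eqVneq x 0; first by rewrite !qform0 mulr0.
  have xT0 : x^T != 0 by rewrite -trmx0 (inj_eq trmx_inj).
  have /v0max : `|x^T|^-1 *: x^T \in S by rewrite inE; exact: S_unit.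
  have c0 : `|x^T|^-1 ^+ 2 > 0 by rewrite exprn_gt0 // invr_gt0 normr_gt0.
  rewrite linearZ /= trmxK !qformZ -mulf_div divff ?gt_eqF // mul1r.
  by rewrite ler_pdivrMr // posN.
exists l => //; exists v0^T; first exact: tr0.
suff /eqP : (M - l *: N) *m v0^T = 0.
  by rewrite mulmxBl -scalemxAl subr_eq0 => /eqP.
rewrite -[M - _]opprB mulNmx; apply/eqP; rewrite oppr_eq0; apply/eqP.
apply: psd_ker => [|y|].
- move: hM symN => /symmetricmxP hM /symmetricmxP symN; apply/symmetricmxP.
  by rewrite linearB linearZ /= hM symN.
- by rewrite -opprB qformMN qformMB oppr_ge0 subr_le0.
- rewrite -opprB qformMN qformMB /l divfK ?subrr ?oppr0 //.
  by rewrite gt_eqF // posN // tr0.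
Qed.

Lemma gen_eigenvalue_qform M N l x :
  M *m x = l *: (N *m x) -> qform M x = l * qform N x.
Proof.
by move=> e; rewrite /qform -!mulmxA e -scalemxAr mxE.
Qed.

(** Every generalized eigenvalue is the quotient of the two forms at its eigenvector, so the
    dominating one is an upper bound lying in the set, hence the supremum. *)
Lemma lambda_maxP M N : (0 < n)%N -> M \is symmetricmx -> posdefmx N ->
  gen_eigenvalues M N (lambda_max M N) /\
  forall x, qform M x <= lambda_max M N * qform N x.
Proof.
move=> n0 hM hN; have [l lE ldom] := gen_eigenvalue_dominating n0 hM hN.
suff -> : lambda_max M N = l by [].
have ub : ubound (gen_eigenvalues M N) l.
  move=> m [v v0 /gen_eigenvalue_qform e]; have := ldom v.
  by rewrite e ler_pM2r // hN.2.
apply/eqP; rewrite eq_le; apply/andP; split.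
  by apply: ge_sup => //; exists l.
by apply: ub_le_sup => //; exists l.
Qed.

Lemma lambda_minP M N : (0 < n)%N -> M \is symmetricmx -> posdefmx N ->
  gen_eigenvalues M N (lambda_min M N) /\
  forall x, lambda_min M N * qform N x <= qform M x.
Proof.
move=> n0 hM hN.
have hMN : - M \is symmetricmx.
  by move: hM => /symmetricmxP hM; apply/symmetricmxP; rewrite linearN /= hM.
have -> : lambda_min M N = - lambda_max (- M) N.
  rewrite /lambda_min /inf; congr (- sup _); apply/seteqP; split => m /=.
    move=> [l [v v0 e] <-]; exists v => //.
    by rewrite mulNmx e scaleNr.
  move=> [v v0 e]; exists (- m); last by rewrite opprK.
  by exists v => //; rewrite scaleNr -e mulNmx opprK.
have [[v v0 e] h] := lambda_maxP n0 hMN hN; split.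
  by exists v => //; rewrite scaleNr -e mulNmx opprK.
by move=> x; have := h x; rewrite qformMN mulNr lerNl.
Qed.

(* [A - (a / b) B] and [C - (c / b) B] sum to 0 over [u] and [v], hence over any
   rotation [w1, w2] of this pair.  Choose the rotation so that the second form
   vanishes at [w1] and [w2]; the first one is nonpositive at one of them, and a
   rescaling of that vector works. *)
Lemma two_point_reduction (A B C : 'M[R]_n) u v : posdefmx B ->
  exists w, [/\ qform B w = qform B u + qform B v,
                qform C w = qform C u + qform C v
              & qform A w <= qform A u + qform A v].
Proof.
move=> hB; pose a := qform A u + qform A v; pose b := qform B u + qform B v.
have [b0|b_neq0] := eqVneq b 0.
  have z x : qform B x = 0 -> x = 0.
    by have [//|/hB.2 h] := eqVneq x 0 => e; rewrite e ltxx in h.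
  move: (b0) => /eqP; rewrite paddr_eq0 ?posdef_qform_ge0 // => /andP[].
  by move=> /eqP/z -> /eqP/z ->; exists 0; rewrite !qform0 addr0.
have b_gt0 : 0 < b by rewrite lt_neqAle eq_sym b_neq0 addr_ge0 ?posdef_qform_ge0.
pose c := qform C u + qform C v.
pose M := A - (a / b) *: B; pose N := C - (c / b) *: B.
pose p := qform N u; pose q := (bform N u v + bform N v u) / 2.
pose r := Num.sqrt (p ^+ 2 + q ^+ 2).
have r2 : r ^+ 2 = p ^+ 2 + q ^+ 2 by rewrite sqr_sqrtr // addr_ge0 ?sqr_ge0.
(* [N] takes opposite values at [u] and [v], so the left side is its form at [x *: u + y *: v]. The
   quadratic formula gives the root [(r - q, p)]; only the direction matters, so it is not
   normalised. *)
have [x [y [xy0 xyN]]] : exists x y : R, 0 < x ^+ 2 + y ^+ 2 /\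
    p * (x ^+ 2 - y ^+ 2) + 2 * q * x * y = 0.
  have [p0|p0] := eqVneq p 0.
    by exists 1, 0; rewrite p0; split; [lra | ring].
  exists (r - q), p; split; last first.
    by rewrite sqrrB r2; ring.
  by rewrite ltr_wpDl ?sqr_ge0 // lt_neqAle eq_sym sqrf_eq0 p0 sqr_ge0.
pose w1 := x *: u + y *: v; pose w2 := (- y) *: u + x *: v.
have rot K : qform K w1 + qform K w2 = (x ^+ 2 + y ^+ 2) * (qform K u + qform K v).
  by rewrite !qform_comb; ring.
have tr (K : 'M[R]_n) : let k := qform K u + qform K v in
    qform (K - (k / b) *: B) u + qform (K - (k / b) *: B) v = 0.
  move=> k; rewrite !qformMB.
  have -> : qform K u - k / b * qform B u + (qform K v - k / b * qform B v) =
    k - k / b * b by rewrite /k /b; ring.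
  by rewrite divfK // subrr.
have trN := tr C; rewrite /= -/c -/N in trN.
have trM := tr A; rewrite /= -/a -/M in trM.
have Nw1 : qform N w1 = 0.
  rewrite qform_comb -/p -[RHS]xyN.
  have -> : qform N v = - p by rewrite /p; lra.
  by rewrite /q; field.
have Nw2 : qform N w2 = 0 by have := rot N; rewrite trN Nw1 mulr0 add0r.
have Mw : qform M w1 + qform M w2 = 0 by rewrite rot trM mulr0.
have Bw : 0 < qform B w1 + qform B w2 by rewrite rot mulr_gt0.
have [w [w0 Nw Mw0]] : exists w, [/\ w != 0, qform N w = 0 & qform M w <= 0].
  have [e1|n1] := eqVneq w1 0.
    exists w2; split => //; last by move: Mw; rewrite e1 qform0; lra.
    by apply: contraTneq Bw => ->; rewrite e1 !qform0 addr0 ltxx.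
  have [h|h] := leP (qform M w1) 0; first by exists w1.
  exists w2; split => //; last by lra.
  by apply: contraTneq h => e; move: Mw; rewrite e qform0 addr0 => ->; rewrite ltxx.
have Bw0 := hB.2 _ w0; pose g := Num.sqrt (b / qform B w).
have g2 : g ^+ 2 = b / qform B w by rewrite sqr_sqrtr // divr_ge0 ?ltW.
have gB : g ^+ 2 * qform B w = b by rewrite g2 divfK // gt_eqF.
(* Because the form of [N] vanishes at [w], scaling the [B]-value to [b] brings the [C]-value to
   [c]. *)
exists (g *: w); rewrite !qformZ gB; split => //.
  have := Nw; rewrite qformMB => /eqP; rewrite subr_eq0 => /eqP ->.
  by rewrite mulrCA gB divfK.
have : qform A w <= a / b * qform B w by rewrite -subr_le0 -qformMB.
move=> /(ler_wpM2l (sqr_ge0 g)) /le_trans; apply.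
by rewrite mulrCA gB divfK.
Qed.

End QuadraticForms.

(** * Quadratic bounds between the square root and its tangents *)

Section SquareRoot.
Context {R : realType}.
Implicit Types a b m M : R.

Lemma sqrt_tangent_gap a b : 0 < a -> 0 <= b ->
  Num.sqrt a + 1 / (2 * Num.sqrt a) * (b - a) - Num.sqrt b =
  (Num.sqrt b - Num.sqrt a) ^+ 2 / (2 * Num.sqrt a).
Proof.
move=> a0 b0; have p0 : Num.sqrt a != 0 by rewrite gt_eqF // sqrtr_gt0.
have := sqr_sqrtr b0; have := sqr_sqrtr (ltW a0).
by move: (Num.sqrt a) (Num.sqrt b) p0 => p q p0 <- <-; field.
Qed.

(** With [p], [q], [r] the roots of [b], [a], [M] in some order of naming, the exact tangent gap
    reduces the claim to a cubic bound: the root of [a] times the squared sum of both roots is at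
    most [4 * r ^+ 3]. *)
Lemma sqrt_le_tangent a b M : 0 < a -> 0 <= b -> a <= M -> b <= M ->
  Num.sqrt b <= Num.sqrt a + 1 / (2 * Num.sqrt a) * (b - a)
                - (b - a) ^+ 2 / (8 * (M * Num.sqrt M)).
Proof.
move=> a0 b0 aM bM; have M0 : 0 < M by exact: lt_le_trans aM.
rewrite lerBrDl addrC -lerBrDl sqrt_tangent_gap //.
have := sqr_sqrtr b0; have := sqr_sqrtr (ltW a0); have := sqr_sqrtr (ltW M0).
have : 0 < Num.sqrt a by rewrite sqrtr_gt0.
have : 0 <= Num.sqrt b by rewrite sqrtr_ge0.
have : Num.sqrt a <= Num.sqrt M by rewrite ler_sqrt // ltW.
have : Num.sqrt b <= Num.sqrt M by rewrite ler_sqrt // ltW.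
move: (Num.sqrt a) (Num.sqrt b) (Num.sqrt M) => p q r qr pr q0 p0 <- <- <-.
have r0 : 0 < r by exact: lt_le_trans pr.
rewrite ler_pdivrMr ?mulr_gt0 ?exprn_gt0 // mulrAC ler_pdivlMr ?mulr_gt0 //.
rewrite -subr_ge0.
have -> : (q - p) ^+ 2 * (8 * (r ^+ 2 * r)) - (q ^+ 2 - p ^+ 2) ^+ 2 * (2 * p) =
  (q - p) ^+ 2 * (2 * (4 * r ^+ 3 - p * (q + p) ^+ 2)) by ring.
rewrite mulr_ge0 ?sqr_ge0 // mulr_ge0 // subr_ge0.
have -> : 4 * r ^+ 3 = r * (r + r) ^+ 2 by ring.
apply: ler_pM; [exact: ltW | exact: sqr_ge0 | by [] |].
by rewrite lerXn2r ?nnegrE ?addr_ge0 ?lerD // ltW.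
Qed.

(** The same cubic comparison reversed, since both roots are now at least that of [m]. *)
Lemma tangent_le_sqrt a b m : 0 < m -> m <= a -> m <= b ->
  Num.sqrt a + 1 / (2 * Num.sqrt a) * (b - a)
    - (b - a) ^+ 2 / (8 * (m * Num.sqrt m)) <= Num.sqrt b.
Proof.
move=> m0 ma mb; have a0 : 0 < a by exact: lt_le_trans ma.
have b0 : 0 < b by exact: lt_le_trans mb.
rewrite lerBlDr -lerBlDl sqrt_tangent_gap ?(ltW b0) //.
have := sqr_sqrtr (ltW b0); have := sqr_sqrtr (ltW a0); have := sqr_sqrtr (ltW m0).
have : 0 < Num.sqrt m by rewrite sqrtr_gt0.
have : Num.sqrt m <= Num.sqrt a by rewrite ler_sqrt // ltW.
have : Num.sqrt m <= Num.sqrt b by rewrite ler_sqrt // ltW.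
move: (Num.sqrt a) (Num.sqrt b) (Num.sqrt m) => p q r rq rp r0 <- <- <-.
have p0 : 0 < p by exact: lt_le_trans rp.
rewrite ler_pdivlMr ?mulr_gt0 ?exprn_gt0 // mulrAC ler_pdivrMr ?mulr_gt0 //.
rewrite -subr_ge0.
have -> : (q ^+ 2 - p ^+ 2) ^+ 2 * (2 * p) - (q - p) ^+ 2 * (8 * (r ^+ 2 * r)) =
  (q - p) ^+ 2 * (2 * (p * (q + p) ^+ 2 - 4 * r ^+ 3)) by ring.
rewrite mulr_ge0 ?sqr_ge0 // mulr_ge0 // subr_ge0.
have -> : 4 * r ^+ 3 = r * (r + r) ^+ 2 by ring.
have q0 : 0 < q by exact: lt_le_trans rq.
apply: ler_pM; [exact: ltW | exact: sqr_ge0 | by [] |].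
by rewrite lerXn2r ?nnegrE ?addr_ge0 ?lerD // ltW.
Qed.

End SquareRoot.

(** * One Frank-Wolfe step and the rate recursion *)

Lemma segment_itv {R : realType} (m M g a b : R) : 0 <= g <= 1 ->
  m <= a <= M -> m <= b <= M -> m <= (1 - g) * a + g * b <= M.
Proof.
move=> /andP[g0 g1] /andP[ma aM] /andP[mb bM].
have g1' : 0 <= 1 - g by rewrite subr_ge0.
have e c : c = (1 - g) * c + g * c by rewrite -mulrDl subrK mul1r.
by rewrite {1}(e m) {1}(e M) !lerD ?ler_wpM2l.
Qed.

Lemma sqr_dist_itv {R : realType} (m M a b : R) :
  m <= a <= M -> m <= b <= M -> (a - b) ^+ 2 <= (M - m) ^+ 2.
Proof.
move=> /andP[ma aM] /andP[mb bM]; rewrite -[leLHS]real_normK ?num_real //.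
rewrite lerXn2r ?nnegrE // ?subr_ge0 ?(le_trans ma) //.
by rewrite ler_norml; lra.
Qed.

(** Smoothness of [- sqrt] bounds the new value by its linear model plus a quadratic term;
    optimality of [(sh, th)] and concavity of the root at [t'] bound the linear part by the gap. The
    coordinate [s] is free, so it can be altered later. *)
Lemma fw_descent {R : realType} (m M K g s t sh th s' t' : R) :
  0 < m -> m <= t <= M -> m <= th <= M -> m <= t' <= M -> 0 <= g <= 1 ->
  (M - m) ^+ 2 / (4 * (m * Num.sqrt m)) <= K ->
  sh - 1 / (2 * Num.sqrt t) * th <= s' - 1 / (2 * Num.sqrt t) * t' ->
  objective (fw_step g (s, t) (sh, th)) - objective (s', t') <=
  (1 - g) * (objective (s, t) - objective (s', t')) + g ^+ 2 * K / 2.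
Proof.
move=> m0 ht hth ht' hg hK hmin; rewrite /objective /=.
have t0 : 0 < t by case/andP: ht => /(lt_le_trans m0).
have t'0 : 0 < t' by case/andP: ht' => /(lt_le_trans m0).
have c0 : 0 < m * Num.sqrt m by rewrite mulr_gt0 // sqrtr_gt0.
have /andP[lo _] := segment_itv hg ht hth.
have low := tangent_le_sqrt m0 (proj1 (andP ht)) lo.
have up : Num.sqrt t' <= Num.sqrt t + 1 / (2 * Num.sqrt t) * (t' - t).
  by rewrite -subr_ge0 sqrt_tangent_gap ?(ltW t'0) //
             divr_ge0 ?sqr_ge0 ?mulr_ge0 ?sqrtr_ge0.
have quad : ((1 - g) * t + g * th - t) ^+ 2 / (8 * (m * Num.sqrt m))
    <= g ^+ 2 * K / 2.
  have -> : ((1 - g) * t + g * th - t) ^+ 2 / (8 * (m * Num.sqrt m)) =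
    g ^+ 2 / 2 * ((th - t) ^+ 2 / (4 * (m * Num.sqrt m))).
    by field; rewrite gt_eqF ?sqrtr_gt0 // gt_eqF.
  rewrite [leRHS]mulrAC ler_wpM2l ?divr_ge0 ?sqr_ge0 //; apply: le_trans hK.
  apply: ler_wpM2r; last exact: sqr_dist_itv.
  by rewrite invr_ge0 mulr_ge0 // ltW.
move: (1 / _) low up hmin => c low up hmin.
have {}hmin : g * (sh - c * th) <= g * (s' - c * t').
  by rewrite ler_wpM2l //; case/andP: hg.
have {}up : g * Num.sqrt t' <= g * (Num.sqrt t + c * (t' - t)).
  by rewrite ler_wpM2l //; case/andP: hg.
by move: (_ / (8 * _)) (g ^+ 2 * K / 2) low quad => ? ?; lra.
Qed.

Lemma two_over_itv {R : realType} (x : R) : 0 <= x -> 0 <= 2 / (x + 2) <= 1.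
Proof.
move=> x0; have x2 : 0 < x + 2 by lra.
by rewrite divr_ge0 ?(ltW x2) //= ler_pdivrMr // mul1r; lra.
Qed.

(** Comes down to [(x + 1) * (x + 3) <= (x + 2) ^+ 2]. *)
Lemma two_over_rate_step {R : realType} (K x h : R) : 0 <= K -> 0 <= x ->
  h <= 2 * K / (x + 2) ->
  (1 - 2 / (x + 2)) * h + (2 / (x + 2)) ^+ 2 * K / 2 <= 2 * K / (x + 1 + 2).
Proof.
move=> K0 x0 hx; have g1 : 0 <= 1 - 2 / (x + 2).
  by rewrite subr_ge0; case/andP: (two_over_itv x0).
apply: le_trans (_ : (1 - 2 / (x + 2)) * (2 * K / (x + 2)) +
  (2 / (x + 2)) ^+ 2 * K / 2 <= _); first by rewrite lerD2r ler_wpM2l.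
rewrite -subr_ge0.
have -> : 2 * K / (x + 1 + 2) - ((1 - 2 / (x + 2)) * (2 * K / (x + 2)) +
  (2 / (x + 2)) ^+ 2 * K / 2) = 2 * K / ((x + 3) * (x + 2) ^+ 2).
  by field; rewrite !gt_eqF //; lra.
by rewrite divr_ge0 ?mulr_ge0 ?sqr_ge0 //; lra.
Qed.

(** * Geometry of [Omega] and the first-order condition at a minimiser *)

Section FrankWolfe.
Context {R : realType} {n : nat}.
Context (A B C : 'M[R]_n) (alpha beta : R).
Context (hB : posdefmx B) (hC : posdefmx C).
Context (halpha : 0 < alpha).

Local Notation Om := (Omega A B C alpha beta).
Local Notation tmax := (t_max B C beta).
Local Notation tmin := (t_min B C alpha).

Lemma Omega_dim_gt0 p : Om p -> (0 < n)%N.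
Proof.
move=> [x /= /andP[ax _] _]; case: (posnP n) => // n0; exfalso.
have x0 : x = 0 by apply/colP => i; have := ltn_ord i; rewrite {2}n0.
by move: ax; rewrite x0 qform0 leNgt halpha.
Qed.

Lemma t_min_gt0 p : Om p -> 0 < tmin.
Proof.
move=> /Omega_dim_gt0 n0; rewrite mulr_gt0 //.
have [[v v0 /gen_eigenvalue_qform e] _] := lambda_minP n0 hB.1 hC.
by have := hB.2 _ v0; rewrite e pmulr_lgt0 // hC.2.
Qed.

Lemma Omega_t_itv p : Om p -> tmin <= p.2 <= tmax.
Proof.
move=> Op; have n0 := Omega_dim_gt0 Op; have tm0 := t_min_gt0 Op.
have l0 : 0 < lambda_min B C by rewrite -(pmulr_lgt0 _ halpha).
case: Op => [x /= /andP[ax xb] <-] /=.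
have [_ hmin] := lambda_minP n0 hB.1 hC.
have [[v v0 /gen_eigenvalue_qform e] hmax] := lambda_maxP n0 hB.1 hC.
have L0 : 0 < lambda_max B C.
  by have := hB.2 _ v0; rewrite e pmulr_lgt0 // hC.2.
apply/andP; split.
  by apply: le_trans (hmin x); rewrite ler_wpM2l // ltW.
by apply: le_trans (hmax x) _; rewrite ler_wpM2l // ltW.
Qed.

(** Scaling the two vectors by [sqrt (1 - l)] and [sqrt l] turns the sums of [two_point_reduction]
    into convex combinations, so the [C]-value stays between [alpha] and [beta]. *)
Lemma Omega_segment_dominated p q l : Om p -> Om q -> 0 <= l <= 1 ->
  exists2 w, Om w & w.2 = (fw_step l p q).2 /\ w.1 <= (fw_step l p q).1.
Proof.
move=> [x hx <-] [y hy <-] hl; have /andP[l0 l1] := hl.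
have [w [wB wC wA]] := two_point_reduction A C
  (Num.sqrt (1 - l) *: x) (Num.sqrt l *: y) hB.
have e (M : 'M[R]_n) : qform M (Num.sqrt (1 - l) *: x) + qform M (Num.sqrt l *: y)
    = (1 - l) * qform M x + l * qform M y.
  by rewrite !qformZ !sqr_sqrtr // subr_ge0.
rewrite !e in wA wB wC; exists (qform A w, qform B w) => //=.
by exists w => //=; rewrite wC; exact: segment_itv.
Qed.

(** The segment from [p] to [q] may leave [Omega], so [p] is compared with the dominating points of
    [Omega]; dividing by [l] gives [0 <= e + l * G] for the slack [e]. *)
Lemma objective_first_order p q :
  is_argmin Om (@objective R) p -> Om q ->
  p.1 + 1 / (2 * Num.sqrt p.2) * (q.2 - p.2) <= q.1.
Proof.
move=> [Op hp] Oq; have m0 := t_min_gt0 Op.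
have /andP[mp _] := Omega_t_itv Op.
set c := 1 / _; set d := q.2 - p.2.
pose G := d ^+ 2 / (8 * (tmin * Num.sqrt tmin)).
have G0 : 0 <= G.
  rewrite divr_ge0 ?sqr_ge0 // mulr_ge0 // mulr_ge0 ?sqrtr_ge0 //; exact: ltW.
pose e := q.1 - p.1 - c * d.
have ineq l : 0 < l -> l <= 1 -> 0 <= e + l * G.
  move=> l0 l1; have hl : 0 <= l <= 1 by rewrite ltW.
  have [w Ow [w2 w1]] := Omega_segment_dominated Op Oq hl.
  have /andP[mw _] := Omega_t_itv Ow.
  have low := tangent_le_sqrt m0 mp mw; have := hp _ Ow.
  rewrite /objective => {}hp.
  have w2p : w.2 - p.2 = l * d by rewrite w2 /d /=; ring.
  rewrite w2p -/c exprMn -(mulrA (l ^+ 2)) -/G in low.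
  rewrite -(pmulr_rge0 _ l0); move: w1; rewrite /e /=; lra.
rewrite -subr_ge0 opprD addrA -/e leNgt; apply/negP => e0.
have den : 0 < - e + G + 1 by lra.
(* If [e < 0], this [l] lies in the unit interval and makes [e + l * G] negative. *)
have l0 : 0 < - e / (- e + G + 1) by rewrite divr_gt0 // oppr_gt0.
have l1 : - e / (- e + G + 1) <= 1 by rewrite ler_pdivrMr // mul1r; lra.
have := ineq _ l0 l1.
have -> : e + - e / (- e + G + 1) * G = e * (1 - e) / (- e + G + 1).
  by field; rewrite gt_eqF.
by rewrite pmulr_lge0 ?invr_gt0 // leNgt nmulr_rlt0 //; lra.
Qed.

(** Adding the tangent condition to [sqrt_le_tangent] cancels the linear terms and leaves the
    quadratic one below the gap. *)
Lemma t_dist_le_gap p t s h :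
  is_argmin Om (@objective R) p -> tmin <= t <= tmax ->
  p.1 + 1 / (2 * Num.sqrt p.2) * (t - p.2) <= s ->
  objective (s, t) - objective p <= h ->
  (t - p.2) ^+ 2 <= 8 * (tmax * Num.sqrt tmax) * h.
Proof.
move=> [Op hp] /andP[mt tM] tangent gap; have m0 := t_min_gt0 Op.
have /andP[mp pM] := Omega_t_itv Op.
have M0 : 0 < tmax by exact: lt_le_trans (lt_le_trans m0 mt) tM.
have up := sqrt_le_tangent (lt_le_trans m0 mp) (le_trans (ltW m0) mt) pM tM.
rewrite mulrC -ler_pdivrMr; last first.
  by apply: mulr_gt0 => //; apply: mulr_gt0; rewrite ?sqrtr_gt0.
move: gap; rewrite /objective /=; move: (_ / (8 * _)) up => ? ?; lra.
Qed.

End FrankWolfe.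

(** * Convergence rate of the iterates *)

Unset Implicit Arguments.
Set Strict Implicit.

Theorem theorem7 (R : realType) (n : nat) (A B C : 'M[R]_n) (alpha beta : R)
    (z zhat : nat -> R * R) (gamma : nat -> R) (zstar : R * R)
    (hA : A \is symmetricmx) (hB : posdefmx B) (hC : posdefmx C)
    (halpha : 0 < alpha) (hbeta : alpha < beta)
    (hfw : frank_wolfe A B C alpha beta z zhat gamma)
    (hstep : diminishing_stepsize gamma \/ exact_line_search z zhat gamma)
    (hsimple : forall k : nat, (1 <= k)%N ->
       simple_spectrum (A - (1 / (2 * Num.sqrt (z k).2)) *: B))
    (hstar : is_argmin (Omega A B C alpha beta) objective zstar) :
  forall k : nat, (1 <= k)%N ->
    `|(z k).2 - zstar.2| <=
      4 * Num.sqrt (t_max B C beta) *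
        Num.sqrt (L_const B C alpha * D_const A B C alpha beta ^+ 2
                    * Num.sqrt (t_max B C beta) / (k%:R + 2)).
Proof.
have [z1 hzhat hz] := hfw; have Ostar := hstar.1.
pose M := t_max B C beta; pose m := t_min B C alpha.
have m0 : 0 < m := t_min_gt0 hB hC halpha Ostar.
have itv p : Omega A B C alpha beta p -> m <= p.2 <= M.
  exact: Omega_t_itv.
have gap_line p (Op : Omega A B C alpha beta p) :=
  objective_first_order hB hC halpha hstar Op.
have cm0 : 0 < 4 * (m * Num.sqrt m)
  by apply: mulr_gt0 => //; apply: mulr_gt0; rewrite ?sqrtr_gt0.
pose K := L_const B C alpha * D_const A B C alpha beta ^+ 2.
have hL : L_const B C alpha = (4 * (m * Num.sqrt m))^-1.
  rewrite /L_const -/m div1r (_ : 3 / 2 = 1 + 2^-1); last by field.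
  rewrite powRD; last by rewrite gt_eqF ?implybT // ltW.
  by rewrite powRr1 ?powR12_sqrt // ltW.
(* The objective is linear in [s], so the [s] part of [D_const ^+ 2] is simply dropped. *)
have hK : (M - m) ^+ 2 / (4 * (m * Num.sqrt m)) <= K.
  rewrite /K hL mulrC; apply: ler_wpM2l; first by rewrite invr_ge0 ltW.
  by rewrite /D_const sqr_sqrtr ?addr_ge0 ?sqr_ge0 // lerDr sqr_ge0.
have K0 : 0 <= K by apply: le_trans hK; rewrite divr_ge0 ?sqr_ge0 // ltW.
have hgamma k : (1 <= k)%N -> 0 <= gamma k <= 1.
  move=> k1; case: hstep => [/(_ _ k1) ->|/(_ _ k1)[]//].
  exact: two_over_itv.
have hz_itv k : (1 <= k)%N -> m <= (z k).2 <= M.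
  elim: k => // -[_ _|k IH _]; first exact: itv.
  by rewrite hz //; apply: segment_itv; rewrite ?hgamma ?IH ?itv //;
     exact: (hzhat _ _).1.
pose c := 1 / (2 * Num.sqrt zstar.2).
(* The condition is affine, so it passes from [Omega] to convex combinations. *)
have hz_line k : (1 <= k)%N -> zstar.1 + c * ((z k).2 - zstar.2) <= (z k).1.
  elim: k => // -[_ _|k IH _]; first exact: gap_line.
  have /andP[g0 g1] := hgamma k.+1 isT; rewrite -subr_ge0 in g1.
  have := ler_wpM2l g0 (gap_line _ (hzhat k.+1 isT).1).
  have := ler_wpM2l g1 (IH isT); rewrite (hz k.+1) //= -/c; lra.
have descent g k s : (1 <= k)%N -> 0 <= g <= 1 ->
    objective (fw_step g (s, (z k).2) (zhat k)) - objective zstar <=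
    (1 - g) * (objective (s, (z k).2) - objective zstar) + g ^+ 2 * K / 2.
  move=> k1 hg; have [Ok hmin] := hzhat k k1.
  rewrite (surjective_pairing (zhat k)) (surjective_pairing zstar).
  apply: fw_descent hK _ => //; first exact: hz_itv.
  - exact: itv.
  - exact: itv.
  - exact: hmin.
(* The value [s] stands in for [(z k).1]; it only has to lie on or above the tangent line at
   [zstar]. *)
suff rate k : (1 <= k)%N ->
    exists2 s, zstar.1 + c * ((z k).2 - zstar.2) <= s &
      objective (s, (z k).2) - objective zstar <= 2 * K / (k%:R + 2).
  move=> k k1; have [s line gap] := rate k k1.
  have k2 : 0 < k%:R + 2 :> R by rewrite ltr_wpDl.
  have M0 : 0 <= M.
    by apply: le_trans (ltW m0) _; case/andP: (itv _ Ostar) => /le_trans; apply.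
  rewrite -/M -/K -ler_sqr ?nnegrE ?mulr_ge0 ?sqrtr_ge0 //.
  rewrite real_normK ?num_real // exprMn sqr_sqrtr; last first.
    by apply: divr_ge0; [rewrite mulr_ge0 ?sqrtr_ge0 | exact: ltW].
  rewrite exprMn sqr_sqrtr //.
  apply: le_trans (t_dist_le_gap hB hC halpha hstar (hz_itv _ k1) line gap) _.
  rewrite -/M le_eqVlt; apply/orP; left; apply/eqP; field.
  by rewrite gt_eqF.
have rate1 : exists2 s, zstar.1 + c * ((z 1%N).2 - zstar.2) <= s &
      objective (s, (z 1%N).2) - objective zstar <= 2 * K / (1 + 2).
  (* On the line the gap is the tangent error of the root, at most [K / 2]. *)
  exists (zstar.1 + c * ((z 1%N).2 - zstar.2)) => //.
  have h1 := hz_itv 1%N isT; have hs := itv _ Ostar.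
  have low := tangent_le_sqrt m0 (proj1 (andP hs)) (proj1 (andP h1)).
  have quad : ((z 1%N).2 - zstar.2) ^+ 2 / (8 * (m * Num.sqrt m)) <= K / 2.
    have -> : ((z 1%N).2 - zstar.2) ^+ 2 / (8 * (m * Num.sqrt m)) =
        ((z 1%N).2 - zstar.2) ^+ 2 / (4 * (m * Num.sqrt m)) / 2.
      by field; rewrite gt_eqF ?sqrtr_gt0 // gt_eqF.
    rewrite ler_wpM2r //; apply: le_trans hK.
    by apply: ler_wpM2r (sqr_dist_itv h1 hs); rewrite invr_ge0 ltW.
  rewrite -/c in low; rewrite /objective /=.
  have -> : 2 * K / (1 + 2) = 2 / 3 * K by field.
  by move: (_ / (8 * _)) low quad => e; lra.
case: hstep => [hdim|hls].
  elim: k => // -[_ _ //|k IH _]; have [s line gap] := IH isT.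
  (* The substitute follows the same steps, leaving the [t] coordinates unchanged. *)
  exists (fw_step (gamma k.+1) (s, (z k.+1).2) (zhat k.+1)).1.
    have /andP[g0 g1] := hgamma k.+1 isT; rewrite -subr_ge0 in g1.
    have := ler_wpM2l g0 (gap_line _ (hzhat k.+1 isT).1).
    have := ler_wpM2l g1 line; rewrite (hz k.+1) //= -/c; lra.
  have -> : (z k.+2).2 = (fw_step (gamma k.+1) (s, (z k.+1).2) (zhat k.+1)).2.
    by rewrite hz.
  rewrite -surjective_pairing.
  apply: le_trans (descent _ k.+1 s isT (hgamma k.+1 isT)) _.
  rewrite hdim // -(natr1 k.+1); exact: two_over_rate_step.
(* Lowering [s] would alter the line search, so the true gap is used, from iteration 2 on. *)
have gap k' : (1 <= k')%N ->
    objective (z k'.+1) - objective zstar <= 2 * K / (k'.+1%:R + 2).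
  have ls j g : (1 <= j)%N -> 0 <= g <= 1 ->
      objective (z j.+1) - objective zstar <=
      (1 - g) * (objective (z j) - objective zstar) + g ^+ 2 * K / 2.
    move=> j1 hg; have := descent g j (z j).1 j1 hg.
    rewrite -surjective_pairing; apply: le_trans; rewrite lerD2r hz //.
    by have [_] := hls j j1; apply; rewrite /= in_itv.
  elim: k' => // -[_ _|k' IH _].
    (* The full step removes the initial gap and leaves [K / 2], which is [2 * K / (2 + 2)]. *)
    apply: le_trans (ls 1%N 1 isT _) _; first by rewrite ler01 lexx.
    by rewrite subrr mul0r add0r expr1n mul1r le_eqVlt; apply/orP; left;
       apply/eqP; field.
  (* Line search does at least as well as the diminishing stepsize. *)
  apply: le_trans (ls k'.+2 _ isT (two_over_itv (ler0n R k'.+2))) _.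
  rewrite -(natr1 k'.+2).
  exact: two_over_rate_step (IH isT).
case: k => [//|[_ //|k _]]; exists (z k.+2).1; first exact: hz_line.
by rewrite -surjective_pairing; exact: gap.
Qed.
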